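(* Let $c_1,\dots,c_k\in\mathbb{R}^d$ ($k\ge2$) be fixed centers, let $X=(x_1,\dots,x_n)\in(\mathbb{R}^d)^n$ with margins $\gamma_1,\dots,\gamma_n$, let $\eta_1,\dots,\eta_n$ be independent random vectors in $\mathbb{R}^d$, and let $X'=(x_1+\eta_1,\dots,x_n+\eta_n)$, $P=A(X)$, $P'=A(X')$. Then $$\mathbb{E}[d(P,P')]\le\frac{2}{n-1}\sum_{i=1}^n\mathbb{P}\!\left(\|\eta_i\|\ge\frac{\gamma_i}{2}\right).$$
   Context: Here $n\ge 2$, $[n]=\{1,\dots,n\}$, and $\|\cdot\|$ is the Euclidean norm on $\mathbb{R}^d$. Nearest-center assignment with a deterministic tie-breaking rule: a fixed function $\ell:\mathbb{R}^d\to\{1,\dots,k\}$ with $\|x-c_{\ell(x)}\|\le\|x-c_j\|$ for all $x\in\mathbb{R}^d$ and all $j$; the point $x$ is assigned to $c_{\ell(x)}$. As is implicit in writing the expectation, the assigned indices $\ell(x_i+\eta_i)$ are random variables (measurable). The induced partition $A(X)$ of $[n]$ is the one in which $i,j$ lie in the same block if and only if $\ell(x_i)=\ell(x_j)$; $A(X')$ uses the same centers and the same $\ell$. With $\ell_i=\ell(x_i)$, the margin of $x_i$ is $\gamma_i=\min_{j\ne\ell_i}\bigl(\|x_i-c_j\|-\|x_i-c_{\ell_i}\|\bigr)$. For partitions $P,Q$ of $[n]$, the partition distance $d(P,Q)$ is $\binom{n}{2}^{-1}$ times the number of pairs $(i,j)$ with $1\le i<j\le n$ such that $i,j$ lie in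 the same block of exactly one of $P$ and $Q$. *)

(* Defs.v *)
From HB Require Import structures.
From mathcomp Require Import all_boot all_order all_algebra.
From mathcomp Require Import all_classical all_reals all_analysis.

Set Implicit Arguments.
Unset Strict Implicit.
Unset Printing Implicit Defensive.

Import Order.TTheory GRing.Theory Num.Theory.
Import numFieldNormedType.Exports.

Local Open Scope classical_set_scope.
Local Open Scope ring_scope.

(* The library norm on matrices is the sup norm, hence this definition. *)
Definition enorm (R : realType) (d : nat) (v : 'rV[R]_d) : R :=
  Num.sqrt (\sum_(i < d) v 0 i ^+ 2).

(* R^d with its Borel sigma-algebra; the topology on 'rV[R]_d is the product
   topology, which is also the one induced by enorm. *)
Definition borel_rV (R : realType) (d : nat) :=
  g_sigma_algebraType (open : set (set 'rV[R]_d)).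

Definition random_vector (dO : measure_display) (Omega : measurableType dO)
    (R : realType) (d : nat) (X : Omega -> 'rV[R]_d) : Prop :=
  measurable_fun setT (X : Omega -> borel_rV R d).

Definition independent_vectors (dO : measure_display)
    (Omega : measurableType dO) (R : realType) (Pr : probability Omega R)
    (d n : nat) (X : 'I_n -> Omega -> 'rV[R]_d) : Prop :=
  forall (J : {set 'I_n}) (B : 'I_n -> set (borel_rV R d)),
    (forall i, measurable (B i)) ->
    Pr (\bigcap_(i in [set` J]) (X i @^-1` B i))
      = (\prod_(i in J) Pr (X i @^-1` B i))%E.

Definition nearest_center (R : realType) (d k : nat) (c : 'I_k -> 'rV[R]_d)
    (l : 'rV[R]_d -> 'I_k) : Prop :=
  forall (x : 'rV[R]_d) (j : 'I_k), enorm (x - c (l x)) <= enorm (x - c j).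

(* For 1 < k this infimum is over a nonempty finite set, hence a minimum:
   see marginP. *)
Definition margin (R : realType) (d k : nat) (c : 'I_k -> 'rV[R]_d)
    (l : 'rV[R]_d -> 'I_k) (x : 'rV[R]_d) : R :=
  inf [set enorm (x - c j) - enorm (x - c (l x)) | j in [set j | j != l x]].

Lemma marginP (R : realType) (d k : nat) (c : 'I_k -> 'rV[R]_d)
    (l : 'rV[R]_d -> 'I_k) (x : 'rV[R]_d) : (1 < k)%N ->
  (exists2 j, j != l x &
     margin c l x = enorm (x - c j) - enorm (x - c (l x))) /\
  (forall j, j != l x ->
     margin c l x <= enorm (x - c j) - enorm (x - c (l x))).
Proof.
move=> k1; set f := fun j => enorm (x - c j) - enorm (x - c (l x)).
have [j0 j0l] : exists j0, j0 != l x.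
  have : (0 < #|predC1 (l x)|)%N by rewrite cardC1 card_ord; case: k k1 {c l f} => [|[]].
  by case/card_gt0P => j; exists j.
have [j1 j1l j1min] := @arg_minP _ _ _ j0 (fun j => j != l x) f j0l.
have -> : margin c l x = f j1.
  apply/eqP; rewrite eq_le; apply/andP; split.
    apply: ge_inf; last by exists j1.
    by exists (f j1) => _ [j jl <-]; exact: j1min.
  apply: lb_le_inf; first by exists (f j0), j0.
  by move=> _ [j jl <-]; exact: j1min.
by split; [exists j1 | exact: j1min].
Qed.

Definition induced_partition (R : realType) (d k n : nat)
    (l : 'rV[R]_d -> 'I_k) (x : 'I_n -> 'rV[R]_d) : {set {set 'I_n}} :=
  preim_partition (fun i => l (x i)) [set: 'I_n]%SET.

Definition same_block (n : nat) (P : {set {set 'I_n}}) (i j : 'I_n) : bool :=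
  [exists B in P, (i \in B) && (j \in B)].

Definition partition_dist (R : realType) (n : nat) (P Q : {set {set 'I_n}}) : R :=
  ('C(n, 2)%:R)^-1 *
  #|[pred p : 'I_n * 'I_n |
      (p.1 < p.2)%N && (same_block P p.1 p.2 (+) same_block Q p.1 p.2)]|%:R.

(* Main.v *)
Require Import Defs.
From HB Require Import structures.
From mathcomp Require Import all_boot all_order all_algebra.
From mathcomp Require Import all_classical all_reals all_analysis.
From mathcomp Require Import measurable_realfun ring lra.

Set Implicit Arguments.
Unset Strict Implicit.
Unset Printing Implicit Defensive.

Import Order.TTheory GRing.Theory Num.Theory.
Import numFieldNormedType.Exports.

Local Open Scope classical_set_scope.
Local Open Scope ring_scope.

(** If adding [eta_i] to [x_i] changes its nearest center from [a] to [b],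
    then two triangle inequalities give
    [|x_i - c_b| - |eta_i| <= |x_i + eta_i - c_b| <= |x_i + eta_i - c_a|
     <= |x_i - c_a| + |eta_i|],
    so [|eta_i|] is at least half the margin of [x_i]
    ([margin_le_of_reassigned]).

    Two indices are in the same block exactly when their labels agree, so the
    two partitions can only disagree on a pair that contains an index whose
    label changed.  If [m] labels change, at most [m * n] pairs are affected
    ([card_disagreements_le]), and division by [n (n - 1) / 2] yields the
    pointwise bound [2 m / (n - 1)] on the partition distance
    ([partition_dist_le]).  Bounding [m] by the number of indices [i] with
    [|eta_i|] at least half the margin and integrating, linearity turns the
    sum of indicators into the sum of probabilities. *)

(** Summing [2 (a_i b_i) (a_j b_j) <= (a_i b_j)^2 + (a_j b_i)^2] over all
    [i, j] gives twice the square of the inequality; unlike the discriminant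
    argument, this never divides by a norm. *)
Lemma cauchy_schwarz_sum (R : rcfType) (d : nat) (a b : 'I_d -> R) :
  \sum_(i < d) a i * b i
    <= Num.sqrt (\sum_(i < d) a i ^+ 2) * Num.sqrt (\sum_(i < d) b i ^+ 2).
Proof.
have sq0 (f : 'I_d -> R) : 0 <= \sum_(i < d) f i ^+ 2.
  by apply: sumr_ge0 => i _; exact: sqr_ge0.
rewrite -sqrtrM // (le_trans (ler_norm _)) // -sqrtr_sqr ler_wsqrtr //.
set A := \sum_(i < d) a i ^+ 2; set B := \sum_(i < d) b i ^+ 2.
rewrite -(ler_pMn2r (n := 2)) // !mulr2n {2}[A * B]mulrC expr2.
rewrite !big_distrlr /= -!big_split /=.
apply: ler_sum => i _; rewrite -!big_split /=; apply: ler_sum => j _.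
have := sqr_ge0 (a i * b j - a j * b i); nra.
Qed.

Lemma enormN (R : realType) (d : nat) (v : 'rV[R]_d) : enorm (- v) = enorm v.
Proof.
by rewrite /enorm; congr Num.sqrt; apply: eq_bigr => i _; rewrite mxE sqrrN.
Qed.

Lemma ler_enormD (R : realType) (d : nat) (u v : 'rV[R]_d) :
  enorm (u + v) <= enorm u + enorm v.
Proof.
have sq0 (w : 'rV[R]_d) : 0 <= \sum_(i < d) w 0 i ^+ 2.
  by apply: sumr_ge0 => i _; exact: sqr_ge0.
have uv0 : 0 <= enorm u + enorm v by rewrite addr_ge0 // sqrtr_ge0.
rewrite -[leRHS](ger0_norm uv0) -sqrtr_sqr ler_wsqrtr // sqrrD !sqr_sqrtr //.
under eq_bigr do rewrite mxE sqrrD.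
rewrite !big_split /= lerD2r lerD2l -mulr2n lerMn2r /=.
exact: cauchy_schwarz_sum.
Qed.

Lemma enorm_continuous (R : realType) (d : nat) :
  continuous (@enorm R d).
Proof.
move=> v; apply: continuous_comp; last exact: sqrt_continuous.
apply: (@continuous_big _ _ +%R) => [|i _ w]; first exact: add_continuous.
by apply: continuousM; exact: coord_continuous.
Qed.

Lemma measurable_enorm_ge (R : realType) (d : nat) (t : R) :
  measurable ([set v | t <= enorm v] : set (borel_rV R d)).
Proof.
rewrite -[X in measurable X]setCK; apply: measurableC.
apply: sub_sigma_algebra; rewrite openC.
have /continuous_closedP/(_ _ (@closed_ge R t)) := @enorm_continuous R d.
exact.
Qed.

(** Moving a point by [e] changes each of its distances to the centers by at
    most [enorm e], so a center can overtake the nearest one only if twice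
    that amount covers the gap between their distances. *)
Lemma margin_le_of_reassigned (R : realType) (d k : nat)
    (c : 'I_k -> 'rV[R]_d) (l : 'rV[R]_d -> 'I_k) (x e : 'rV[R]_d) :
  (1 < k)%N -> nearest_center c l -> l (x + e) != l x ->
  margin c l x / 2 <= enorm e.
Proof.
move=> k1 nl neq; have [_ /(_ _ neq) gap] := marginP c l x k1.
have near := nl (x + e) (l x).
have shift (y : 'rV[R]_d) : enorm (x - y) <= enorm (x + e - y) + enorm e.
  rewrite -[in leRHS](enormN e); apply: le_trans (ler_enormD _ _).
  by rewrite addrAC addrK.
have shift' (y : 'rV[R]_d) : enorm (x + e - y) <= enorm (x - y) + enorm e.
  by rewrite addrAC ler_enormD.
have := shift (c (l (x + e))); have := shift' (c (l x)).
by rewrite ler_pdivrMr //; lra.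
Qed.

Lemma same_block_induced (R : realType) (d k n : nat)
    (l : 'rV[R]_d -> 'I_k) (x : 'I_n -> 'rV[R]_d) (i j : 'I_n) :
  same_block (induced_partition l x) i j = (l (x i) == l (x j)).
Proof.
apply/existsP/idP => [[B /and3P[/imsetP[h _ ->]]]|lij].
  by rewrite !inE => /eqP <- /eqP <-.
exists [set j | l (x i) == l (x j)]%SET; rewrite !inE eqxx lij !andbT.
by apply/imsetP; exists i => //; apply/setP => h; rewrite !inE.
Qed.

(** A pair on which the two partitions disagree contains a changed index.
    Listing that index first encodes the pair as a changed index followed by
    an arbitrary one, and the encoding is injective because [p.1 < p.2]
    determines the original order. *)
Lemma card_disagreements_le (R : realType) (d k n : nat)
    (l : 'rV[R]_d -> 'I_k) (x y : 'I_n -> 'rV[R]_d) :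
  (#|[pred p : 'I_n * 'I_n | (p.1 < p.2)%N &&
      (same_block (induced_partition l x) p.1 p.2 (+)
       same_block (induced_partition l y) p.1 p.2)]|
   <= #|[pred i | l (y i) != l (x i)]| * n)%N.
Proof.
set D := [pred p | _]; set M := [pred i | _].
pose f (p : 'I_n * 'I_n) := if p.1 \in M then p else (p.2, p.1).
have f_inj : {in D &, injective f}.
  move=> [i j] [i' j']; rewrite !inE /= => /andP[ij _] /andP[ij' _].
  have [ge_ij ge_ij'] := (ltnW ij, ltnW ij').
  rewrite /f /=; case: ifP => _; case: ifP => _ [ei ej]; subst => //.
    by rewrite ltnNge ge_ij' in ij.
  by rewrite ltnNge ge_ij' in ij.
rewrite -[X in (_ * X)%N]card_ord -cardX -(card_in_image f_inj).
apply: fintype.subset_leq_card.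
apply/fintype.subsetP => _ /fintype.imageP[[i j] Dij ->].
rewrite inE /= andbT /f /=; case: ifP => //= Mi.
move: Dij Mi; rewrite !inE /= !same_block_induced => /andP[_ dis].
move=> /negbFE/eqP Mi; apply: contraTN dis => /eqP Mj.
by rewrite Mi Mj addbb.
Qed.

Lemma partition_dist_le (R : realType) (d k n : nat)
    (l : 'rV[R]_d -> 'I_k) (x y : 'I_n -> 'rV[R]_d) : (1 < n)%N ->
  partition_dist R (induced_partition l x) (induced_partition l y)
    <= 2 / (n%:R - 1) * \sum_(i < n) (l (y i) != l (x i))%:R.
Proof.
move=> n1.
have -> : \sum_(i < n) (l (y i) != l (x i))%:R
        = #|[pred i | l (y i) != l (x i)]|%:R :> R.
  by rewrite -natr_sum -sum1_card [in RHS]big_mkcond.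
have n_gt0 : (0 : R) < n%:R by rewrite ltr0n ltnW.
have n1_gt0 : (0 : R) < n%:R - 1 by rewrite subr_gt0 ltr1n.
have binE : 'C(n, 2)%:R = n%:R * (n%:R - 1) / 2 :> R.
  apply: (canRL (mulfK _)); first by rewrite pnatr_eq0.
  rewrite -natrM -[2%N]/(2`!) bin_ffact !ffactnS ffactn0 muln1 natrM.
  by rewrite -subn1 natrB // ltnW.
rewrite /partition_dist binE.
have := card_disagreements_le l x y; rewrite -(ler_nat R) natrM => le_card.
apply: le_trans (ler_wpM2l _ le_card) _.
  by rewrite invr_ge0 divr_ge0 // mulr_ge0 // ltW.
set m := #|[pred i | _]|%:R.
rewrite [leLHS](_ : _ = 2 / (n%:R - 1) * m) //; field.
by rewrite !gt_eqF.
Qed.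

(** The integral of a nonnegative function is a supremum over the simple
    functions below it, so it is monotone for arbitrary nonnegative
    integrands. *)
Lemma ge0_le_integralT d (T : measurableType d) (R : realType)
    (mu : {measure set T -> \bar R}) (f g : T -> \bar R) :
  (forall w, 0 <= f w)%E -> (forall w, f w <= g w)%E ->
  (\int[mu]_w f w <= \int[mu]_w g w)%E.
Proof.
move=> f0 fg; have g0 w : (0 <= g w)%E by exact: le_trans (fg w).
rewrite !ge0_integralTE //; apply: ereal_sup_le.
by apply: image_subset => h hf w; exact: le_trans (hf w) (fg w).
Qed.

Theorem corollary8p7 (R : realType) (d k n : nat)
    (hk : (2 <= k)%N) (hn : (2 <= n)%N)
    (c : 'I_k -> 'rV[R]_d) (l : 'rV[R]_d -> 'I_k) (hl : nearest_center c l)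
    (dO : measure_display) (Omega : measurableType dO)
    (Pr : probability Omega R)
    (x : 'I_n -> 'rV[R]_d) (eta : 'I_n -> Omega -> 'rV[R]_d)
    (heta : forall i, random_vector (eta i))
    (hindep : independent_vectors Pr eta)
    (hmeas : forall (i : 'I_n) (A : set 'I_k),
       measurable ((fun w => l (x i + eta i w)) @^-1` A)) :
  ('E_Pr[fun w => partition_dist R (induced_partition l x)
                    (induced_partition l (fun i => (x i + eta i w)%R))]
   <= (2 / (n%:R - 1))%:E *
      \sum_(i < n) Pr [set w | (enorm (eta i w) >= margin c l (x i) / 2)%R])%E.
Proof.
pose E i := [set w | (enorm (eta i w) >= margin c l (x i) / 2)%R].
have mE i : measurable (E i).
  rewrite -[E i]setTI.
  exact: (heta i measurableT _ (@measurable_enorm_ge R d _)).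
have coef_ge0 : 0 <= 2 / (n%:R - 1) :> R.
  by rewrite divr_ge0 // subr_ge0 ler1n ltnW.
rewrite unlock.
apply: (@le_trans _ _
  (\int[Pr]_w ((2 / (n%:R - 1))%:E * \sum_(i < n) (\1_(E i) w)%:E))%E).
  apply: ge0_le_integralT => w.
    by rewrite lee_fin mulr_ge0 // invr_ge0.
  rewrite sumEFin -EFinM lee_fin.
  apply: le_trans (partition_dist_le l x _ hn) _.
  apply: ler_wpM2l => //; apply: ler_sum => i _.
  rewrite indicE ler_nat; case: eqP => //= /eqP neq.
  rewrite mem_set //=; exact: margin_le_of_reassigned neq.
have mE1 i : measurable_fun setT (fun w => (\1_(E i) w)%:E : \bar R).
  by apply/measurable_EFinP; exact: measurable_indic.
rewrite ge0_integralZl_EFin //.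
- rewrite ge0_integral_sum //.
  by under eq_bigr do rewrite integral_indic // setIT.
- by move=> w _; apply: sume_ge0 => i _; rewrite lee_fin.
- exact: emeasurable_sum.
Qed.
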